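(* Let $b,c,e$ be integers with $e\neq 0$ such that the point $(x,y)=(b/e^2,\,c/e^3)$ lies on the elliptic curve $E_6: y^2=x^3-36x$. Put $$X=b^4+1296e^8+864be^6+72b^2e^4+144ce^5-24b^3e^2+4b^2ce,$$ $$Y=-864be^6-b^4-1296e^8-72b^2e^4+144ce^5+24b^3e^2+4b^2ce,$$ $$U=4(b^2+36e^4)ce,$$ $$V=(b^2-36e^4-12be^2)(b^2-36e^4+12be^2).$$ Then $(X,Y,U,V)$ is an integer solution of the Diophantine equation $X^4+Y^4=2(U^4+V^4)$. *)

(* Defs.v *)
From mathcomp Require Import all_boot all_order all_algebra.

Set Implicit Arguments.
Unset Strict Implicit.
Unset Printing Implicit Defensive.

Import Order.TTheory GRing.Theory Num.Theory.
Local Open Scope ring_scope.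

Definition on_E6 (x y : rat) : Prop := y ^+ 2 = x ^+ 3 - 36 * x.

Definition quartic_solution (X Y U V : int) : Prop :=
  X ^+ 4 + Y ^+ 4 = 2 * (U ^+ 4 + V ^+ 4).

(* Main.v *)
Require Import Defs.
From mathcomp Require Import all_boot all_order all_algebra.
From mathcomp Require Import ring.

Import Order.TTheory GRing.Theory Num.Theory.
Local Open Scope ring_scope.

(** Write [d = b^2 - 36 e^4] and [t = 12 b e^2], so that
    [d^2 + t^2 = (b^2 + 36 e^4)^2], and put [p = d - t], [q = d + t].
    The four given polynomials are then [X = U + p^2], [Y = U - p^2], [U] and
    [V = p q].  Expanding, the odd powers of [U] cancel in [X^4 + Y^4], and
    [X^4 + Y^4 = 2 (U^4 + V^4)] amounts to [6 U^2 p^4 + p^8 = p^4 q^4], which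
    follows from [6 U^2 = q^4 - p^4] ([quartic_of_sqr_shift]).
    This last relation is the elliptic curve: [q^4 - p^4 = 8 d t (d^2 + t^2)],
    whereas [U^2 = 16 c^2 e^2 (d^2 + t^2)], so the two sides agree as soon as
    [c^2 = b d], the equation of the curve cleared of denominators
    ([on_E6_clear_denominators]). *)

Lemma on_E6_clear_denominators (b c e : int) : e != 0 ->
  on_E6 (b%:~R / e%:~R ^+ 2) (c%:~R / e%:~R ^+ 3) ->
  c ^+ 2 = b * (b ^+ 2 - 36 * e ^+ 4).
Proof.
move=> e_neq0 E6; apply: (@intr_inj rat).
have eQ_neq0 : e%:~R != 0 :> rat by rewrite intr_eq0.
transitivity ((c%:~R / e%:~R ^+ 3) ^+ 2 * e%:~R ^+ 6 : rat); first by field.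
by rewrite E6; field.
Qed.

(** [(U + r)^4 + (U - r)^4 = 2 (U^4 + 6 U^2 r^2 + r^4)]; for [r = p^2] the
    hypothesis turns [r^2 (6 U^2 + r^2)] into the fourth power [(p q)^4]. *)
Lemma quartic_of_sqr_shift (R : comNzRingType) (p q U : R) :
  6 * U ^+ 2 = q ^+ 4 - p ^+ 4 ->
  (U + p ^+ 2) ^+ 4 + (U - p ^+ 2) ^+ 4 = 2 * (U ^+ 4 + (p * q) ^+ 4).
Proof.
move=> U2.
transitivity (2 * (U ^+ 4 + p ^+ 4 * (6 * U ^+ 2 + p ^+ 4))); first by ring.
by rewrite U2; ring.
Qed.

Theorem mainTheorem1 (b c e : int) (he : e != 0)
  (hE6 : on_E6 (b%:~R / e%:~R ^+ 2) (c%:~R / e%:~R ^+ 3)) :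
  let X : int := b ^+ 4 + 1296 * e ^+ 8 + 864 * b * e ^+ 6
    + 72 * b ^+ 2 * e ^+ 4 + 144 * c * e ^+ 5 - 24 * b ^+ 3 * e ^+ 2
    + 4 * b ^+ 2 * c * e in
  let Y : int := - 864 * b * e ^+ 6 - b ^+ 4 - 1296 * e ^+ 8
    - 72 * b ^+ 2 * e ^+ 4 + 144 * c * e ^+ 5 + 24 * b ^+ 3 * e ^+ 2
    + 4 * b ^+ 2 * c * e in
  let U : int := 4 * (b ^+ 2 + 36 * e ^+ 4) * c * e in
  let V : int := (b ^+ 2 - 36 * e ^+ 4 - 12 * b * e ^+ 2)
    * (b ^+ 2 - 36 * e ^+ 4 + 12 * b * e ^+ 2) in
  quartic_solution X Y U V.
Proof.
move=> X Y U V.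
have c2 := on_E6_clear_denominators _ _ _ he hE6.
pose p : int := b ^+ 2 - 36 * e ^+ 4 - 12 * b * e ^+ 2.
pose q : int := b ^+ 2 - 36 * e ^+ 4 + 12 * b * e ^+ 2.
have U2 : 6 * U ^+ 2 = q ^+ 4 - p ^+ 4.
  transitivity (96 * (b ^+ 2 + 36 * e ^+ 4) ^+ 2 * e ^+ 2 * c ^+ 2).
    by rewrite /U; ring.
  by rewrite c2 /p /q; ring.
have -> : X = U + p ^+ 2 by rewrite /X /U /p; ring.
have -> : Y = U - p ^+ 2 by rewrite /Y /U /p; ring.
exact: quartic_of_sqr_shift.
Qed.
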